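(* Let $z>0$, let $\phi(x;z)=x^2-z^2$, and let $P_n=P_n(x;z)$ be the monic truncated Hermite polynomials with recurrence coefficients $\gamma_n=\gamma_n(z)$ (conventions: $P_{-1}=P_{-2}=0$, $\gamma_0=\gamma_{-1}=0$). Then for all $n\ge 0$, $$\phi(x;z)\,\partial_{x}P_{n+1}=(n+1)P_{n+2}+\lambda_{n}P_{n}+\tau_{n}P_{n-2},$$ where $$\lambda_{n}(z)=\left[2\left(\gamma_{n}+\gamma_{n+1}+\gamma_{n+2}-z^{2}-1\right)-n\right]\gamma_{n+1}$$ and $$\tau_{n}(z)=2\gamma_{n+1}\gamma_{n}\gamma_{n-1}.$$
   Context: For $z>0$ let $L[p]=\int_{-z}^{z}p(x)e^{-x^{2}}dx$, $p\in\mathbb{R}[x]$. The truncated Hermite polynomials $P_n(x;z)$, $n\ge0$, are the monic polynomials in $x$ with $\deg P_n=n$ and $L[P_kP_n]=h_n(z)\delta_{k,n}$, where $h_n(z)=L[P_n^2]>0$. They satisfy the three-term recurrence $xP_n(x;z)=P_{n+1}(x;z)+\gamma_n(z)P_{n-1}(x;z)$ with $P_{-1}=0$, $P_0=1$, where $\gamma_n(z)=h_n(z)/h_{n-1}(z)$ for $n\ge1$. *)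

(* Defs.v *)
From HB Require Import structures.
From mathcomp Require Import all_boot all_order all_algebra.
From mathcomp Require Import all_classical all_reals all_analysis.

Set Implicit Arguments.
Unset Strict Implicit.
Unset Printing Implicit Defensive.

Import Order.TTheory GRing.Theory Num.Theory.
Import numFieldNormedType.Exports.

Local Open Scope classical_set_scope.
Local Open Scope ring_scope.

Definition hermite_functional (R : realType) (z : R) (p : {poly R}) : R :=
  \int[@lebesgue_measure R]_(x in `[- z, z]) (p.[x] * expR (- x ^+ 2)).

Definition sq_norm (R : realType) (z : R) (P : nat -> {poly R}) (n : nat) : R :=
  hermite_functional z (P n ^+ 2).

(* For 0 < z, [hermite_functional z] is positive definite, so exactly one
   family satisfies this predicate, and its [sq_norm z P n] are positive. *)
Definition truncated_hermite (R : realType) (z : R) (P : nat -> {poly R}) : Prop :=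
  (forall n : nat, P n \is monic /\ size (P n) = n.+1) /\
  (forall k n : nat,
     hermite_functional z (P k * P n) = if k == n then sq_norm z P n else 0).

Definition poly_ext (R : realType) (P : nat -> {poly R}) (m : int) : {poly R} :=
  if m is Posz n then P n else 0.

(* Integer indices make the convention that the coefficient vanishes at 0 and
   at -1 meaningful: [n%:Z - 1] is not truncated. *)
Definition rec_coef (R : realType) (z : R) (P : nat -> {poly R}) (m : int) : R :=
  if m is Posz n.+1 then sq_norm z P n.+1 / sq_norm z P n else 0.

Definition phi (R : realType) (z : R) : {poly R} := 'X ^+ 2 - (z ^+ 2)%:P.

Definition lambda (R : realType) (z : R) (P : nat -> {poly R}) (n : nat) : R :=
  let gamma := rec_coef z P in
  (2 * (gamma n + gamma n.+1 + gamma n.+2 - z ^+ 2 - 1) - n%:R) * gamma n.+1.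

Definition tau (R : realType) (z : R) (P : nat -> {poly R}) (n : nat) : R :=
  let gamma := rec_coef z P in
  2 * gamma n.+1 * gamma n * gamma (n%:Z - 1).

(* Main.v *)
(* Both sides of the structure relation are compared through their moments
   against every P_k, which determine a polynomial because L is positive
   definite. Since phi vanishes at +-z, integrating (phi q exp(-x^2))' gives the
   Pearson equation L[phi q'] = L[2x (phi - 1) q]. It moves the derivative in
   L[phi P_{n+1}' P_k] from P_{n+1} to P_k, so degree considerations leave only
   n - 2 <= k <= n + 2; parity removes k = n - 1 and k = n + 1; k = n - 2 and
   k = n + 2 are read off leading coefficients, and k = n follows from the
   three-term recurrence applied to L[x^3 P_n P_{n+1}]. *)
Require Import Defs.
From HB Require Import structures.
From mathcomp Require Import all_boot all_order all_algebra.
From mathcomp Require Import all_classical all_reals all_analysis.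
From mathcomp Require Import ring zify.

Set Implicit Arguments.
Unset Strict Implicit.
Unset Printing Implicit Defensive.

Import Order.TTheory GRing.Theory Num.Theory.
Import numFieldNormedType.Exports.

Local Open Scope classical_set_scope.
Local Open Scope ring_scope.

(** * Orthogonal expansion for a definite linear functional on polynomials *)

Section orthogonal_polynomials.
Variables (R : numFieldType) (L : {scalar {poly R}}) (P : nat -> {poly R}).
Hypothesis L_sqr_eq0 : forall q, L (q ^+ 2) = 0 -> q = 0.
Hypothesis P_monic : forall n, P n \is monic.
Hypothesis size_P : forall n, size (P n) = n.+1.
Hypothesis P_orth : forall k n, k != n -> L (P k * P n) = 0.

Local Notation h n := (L (P n ^+ 2)).

Let LPP k n : L (P k * P n) = if k == n then h n else 0.
Proof. by case: eqVneq => [->//|/P_orth]. Qed.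

Let h_neq0 n : h n != 0.
Proof.
by apply/eqP => /L_sqr_eq0 Pn0; have := size_P n; rewrite Pn0 size_poly0.
Qed.

Let coef_P n : (P n)`_n = 1.
Proof. by have /monicP := P_monic n; rewrite lead_coefE size_P. Qed.

Let coef_P_gt n k : (n < k)%N -> (P n)`_k = 0.
Proof. by move=> nk; rewrite nth_default// size_P. Qed.

Let size_sub_lead m (r : {poly R}) :
  (size r <= m.+1)%N -> (size (r - r`_m *: P m)%R <= m)%N.
Proof.
move=> rm; apply/leq_sizeP => j; rewrite leq_eqVlt => /predU1P[<-|mj].
  by rewrite coefB coefZ coef_P mulr1 subrr.
by rewrite coefB coefZ coef_P_gt// mulr0 subr0 nth_default// (leq_trans rm).
Qed.

Lemma orth_span m (q r : {poly R}) :
  (forall k, (k < m)%N -> L (P k * q) = 0) -> (size r <= m)%N -> L (r * q) = 0.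
Proof.
elim: m r => [|m IHm] r Pq.
  by rewrite leqn0 size_poly_eq0 => /eqP->; rewrite mul0r raddf0.
move=> /size_sub_lead rm; rewrite -[r](subrK (r`_m *: P m)) mulrDl raddfD/=.
rewrite IHm// => [|k km]; last by rewrite Pq// ltnW.
by rewrite -scalerAl scalarZ Pq// mulr0 addr0.
Qed.

Lemma orth_size n (q : {poly R}) : (size q <= n)%N -> L (q * P n) = 0.
Proof. by apply: orth_span => k kn; rewrite P_orth// ltn_eqF. Qed.

Lemma orth_lead n (q : {poly R}) :
  (size q <= n.+1)%N -> L (q * P n) = q`_n * h n.
Proof.
move=> /size_sub_lead qn; rewrite -[q in LHS](subrK (q`_n *: P n)) mulrDl.
by rewrite raddfD/= orth_size// add0r -scalerAl scalarZ.
Qed.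

(** By [orth_span], [p - q] is orthogonal to itself, and definiteness applies. *)
Lemma orth_eq (p q : {poly R}) : (forall k, L (p * P k) = L (q * P k)) -> p = q.
Proof.
move=> pq; apply/eqP; rewrite -subr_eq0; apply/eqP/L_sqr_eq0.
rewrite expr2; apply: (@orth_span (size (p - q))) => // k _.
by rewrite mulrC mulrBl raddfB/= pq subrr.
Qed.

(** * Parity under an even functional *)

Hypothesis L_comp_opp : forall q, L (q \Po - 'X) = L q.

Lemma functional_odd_eq0 n (q : {poly R}) :
  odd n -> q \Po - 'X = (-1) ^+ n *: q -> L q = 0.
Proof.
move=> on qn; have := L_comp_opp q.
rewrite qn -signr_odd on scalarZ mulN1r => /eqP.
by rewrite eq_sym -addr_eq0 -mulr2n mulrn_eq0/= => /eqP.
Qed.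

Lemma comp_opp_mul m n (p q : {poly R}) :
  p \Po - 'X = (-1) ^+ m *: p -> q \Po - 'X = (-1) ^+ n *: q ->
  (p * q) \Po - 'X = (-1) ^+ (m + n) *: (p * q).
Proof.
by move=> pm qn; rewrite comp_polyM pm qn -scalerAl -scalerAr scalerA exprD.
Qed.

Lemma comp_opp_deriv n (q : {poly R}) :
  q \Po - 'X = (-1) ^+ n *: q -> q^`() \Po - 'X = (-1) ^+ n.+1 *: q^`().
Proof.
move=> /(congr1 (@deriv R)); rewrite deriv_comp derivN derivX derivZ mulrN1.
by move=> /eqP; rewrite eqr_oppLR => /eqP ->; rewrite exprS mulN1r scaleNr.
Qed.

Lemma size_comp_opp (q : {poly R}) : size (q \Po - 'X) = size q.
Proof. by rewrite size_comp_poly2// size_polyN size_polyX. Qed.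

Lemma coef_comp_opp (q : {poly R}) k : (q \Po - 'X)`_k = (-1) ^+ k * q`_k.
Proof.
elim/poly_ind: q k => [|q c IHq] k; first by rewrite comp_poly0 coef0 mulr0.
rewrite comp_poly_MXaddC mulrN coefD coefN !coefMX coefD coefMX !coefC.
case: k => [|k] /=; first by rewrite oppr0 expr0 mul1r.
by rewrite !addr0 IHq exprS mulN1r mulNr.
Qed.

(** Both sides are tested against [P k]. For [k < n] the evenness of [L] moves the substitution onto
    [P k], whose size is unchanged, so both moments vanish. For [n <= k] only the coefficient of
    index [k] matters. *)
Lemma orth_parity n : P n \Po - 'X = (-1) ^+ n *: P n.
Proof.
apply: orth_eq => k; have [kn|nk] := ltnP k n.
  rewrite -scalerAl scalarZ P_orth ?gtn_eqF// mulr0 -L_comp_opp comp_polyM.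
  rewrite -comp_polyA raddfN/= comp_polyX opprK comp_polyXr mulrC.
  by rewrite orth_size// size_comp_opp size_P.
rewrite [LHS]orth_lead ?[RHS]orth_lead; last 2 first.
- by rewrite (leq_trans (size_scale_leq _ _))// size_P.
- by rewrite size_comp_opp size_P.
congr (_ * _); rewrite coefZ coef_comp_opp.
by move: nk; rewrite leq_eqVlt => /predU1P[->//|nk]; rewrite coef_P_gt ?mulr0.
Qed.

(** * Three-term recurrence *)

Definition recurrence_coef n := if n is m.+1 then h m.+1 / h m else 0.
Arguments recurrence_coef : simpl never.
Local Notation gamma := recurrence_coef.

Let gamma0 : gamma 0 = 0. Proof. by []. Qed.

Let gammaS n : gamma n.+1 * h n = h n.+1.
Proof. by rewrite /recurrence_coef divfK. Qed.

Let size_XP n : size ('X * P n) = n.+2.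
Proof. by rewrite mulrC size_mulX ?size_P// -size_poly_eq0 size_P. Qed.

Let X_parity : 'X \Po - 'X = (-1) ^+ 1 *: 'X :> {poly R}.
Proof. by rewrite comp_polyX scaleN1r. Qed.

(** The moment is symmetric in [n] and [k], so [n <= k] may be assumed. It vanishes by parity when
    [n = k]; otherwise ['X * P n] has degree at most [k] and its coefficient of index [k]
    decides. *)
Lemma orth_mulX n k :
  L ('X * P n * P k) =
  if k == n.+1 then h k else if n == k.+1 then h n else 0.
Proof.
wlog nk : n k / (n <= k)%N => [hw|].
  case: (leqP n k) => [/hw//|kn]; rewrite mulrAC hw 1?ltnW//.
  by do 2 case: eqP => //; lia.
have [->|nk'] := eqVneq n k.
  rewrite !ltn_eqF//; apply: (@functional_odd_eq0 (1 + k + k)).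
    by rewrite -addnA addnn /= odd_double.
  by apply: comp_opp_mul; [apply: comp_opp_mul|]; rewrite // orth_parity.
rewrite orth_lead ?size_XP; last by lia.
rewrite coefXM; case: k nk nk' => [|k] nk nk'; first by lia.
rewrite /= eqSS; case: eqVneq => [<-|kn]; first by rewrite coef_P mul1r.
by rewrite coef_P_gt ?mul0r; [case: eqP => //; lia|lia].
Qed.

(** At [n = 0] the truncated index [n.-1] does no harm, since [gamma 0 = 0]. *)
Lemma three_term n : 'X * P n = P n.+1 + gamma n *: P n.-1.
Proof.
apply: orth_eq => k; rewrite orth_mulX mulrDl raddfD/= -scalerAl scalarZ.
rewrite [L (P n.+1 * P k)]LPP [L (P n.-1 * P k)]LPP.
rewrite (eq_sym n.+1); case: eqVneq => [->|kn].
  by case: n => [|n]; rewrite ?gamma0 ?mul0r ?addr0// ltn_eqF ?mulr0 ?addr0.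
case: n kn => [|n] kn; first by rewrite gamma0 mul0r addr0.
by rewrite eqSS add0r; case: eqP => [->|]; rewrite ?gammaS ?mulr0.
Qed.

(** * Structure relation from the Pearson equation *)

Variable z : R.
Let f : {poly R} := 'X ^+ 2 - (z ^+ 2)%:P.
Hypothesis L_pearson : forall q, L (f * q^`()) = L (2 *: 'X * (f - 1) * q).

Let coef_fM (q : {poly R}) i : (f * q)`_i.+2 = q`_i - z ^+ 2 * q`_i.+2.
Proof. by rewrite mulrBl coefB coefXnM coefCM subn2. Qed.

Let f_parity : f \Po - 'X = (-1) ^+ 0 *: f.
Proof. by rewrite expr0 scale1r comp_polyB comp_Xn_poly comp_polyC sqrrN. Qed.

(** The cofactor of [P n] once the derivative has been moved from [P n] to [P k]; see
    [L_structure]. *)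
Let g k : {poly R} := 2 *: 'X * (f - 1) * P k - f * (P k)^`().

(** In degrees [k + 3] and above only the term [2 X^3 P_k] of [g k] contributes. *)
Let coef_g k i : (k <= i)%N -> (g k)`_i.+3 = 2 * (P k)`_i.
Proof.
move=> ki; have [k2 k4] : (k < i.+2)%N /\ (k < i.+4)%N by lia.
rewrite coefB coef_fM !coef_deriv -!scalerAl coefZ -mulrA coefXM /=.
rewrite mulrBl mul1r coefB coef_fM (coef_P_gt k2) (coef_P_gt k4).
by rewrite !(mulr0, mul0rn, subr0, scaler0).
Qed.

(** The Pearson equation for [P n * P k], with the product rule. *)
Let L_structure n k : L (f * (P n)^`() * P k) = L (g k * P n).
Proof.
have := L_pearson (P n * P k); set u := 2 *: 'X * (f - 1) => Luf.
rewrite (_ : g k * P n = u * (P n * P k) - f * (P n * (P k)^`())); last first.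
  by rewrite /g -/u; ring.
by rewrite raddfB/= -Luf -raddfB/= derivM; congr (L _); ring.
Qed.

Let L_structure_low n k : (k <= n)%N ->
  L (f * (P n.+3)^`() * P k) = (if k == n then 2 * h n.+3 else 0).
Proof.
move=> kn; rewrite L_structure orth_lead ?coef_g//; last first.
  apply/leq_sizeP => -[|[|[|j]]] nj; [by lia|by lia|by lia|].
  by rewrite coef_g ?coef_P_gt ?mulr0//; lia.
case: eqVneq => [->|nk]; first by rewrite coef_P mulr1.
by rewrite coef_P_gt ?mulr0 ?mul0r// ltn_neqAle nk.
Qed.

Let L_structure_diag n :
  L (f * (P n.+1)^`() * P n) =
  (2 * (gamma n + gamma n.+1 + gamma n.+2 - z ^+ 2 - 1) - n%:R) * h n.+1.
Proof.
have LX k : L ('X * P k * P k.+1) = h k.+1 by rewrite orth_mulX eqxx.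
have LX' k : L ('X * P k.+1 * P k) = h k.+1 by rewrite mulrAC LX.
have LfP : L (f * (P n)^`() * P n.+1) = n%:R * h n.+1.
  rewrite orth_lead; last first.
    apply/leq_sizeP => -[|[|j]] nj; [by lia|by lia|].
    by rewrite coef_fM !coef_deriv !coef_P_gt ?mul0rn ?mulr0 ?subr0//; lia.
  case: (n) => [|m].
    rewrite (_ : (P 0)^`() = 0) ?mulr0 ?coef0//.
    by apply/polyP => j; rewrite coef_deriv coef_P_gt// mul0rn coef0.
  rewrite coef_fM !coef_deriv coef_P (@coef_P_gt _ m.+3)//.
  by rewrite mul0rn mulr0 subr0.
(* Expanding both inner products by [three_term] leaves four moments: the one pairing [P n.+2] with
   [P n.-1] contributes nothing, and the others give the three [gamma] terms. *)
have LX3 : L ('X * ('X * P n.+1) * ('X * P n)) =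
    (gamma n + gamma n.+1 + gamma n.+2) * h n.+1.
  rewrite (three_term n.+1) (three_term n) -[n.+1.-1]/n.
  rewrite (_ : _ * _ = 'X * P n.+2 * P n.+1 + gamma n *: ('X * P n.+2 * P n.-1)
      + gamma n.+1 *: ('X * P n * P n.+1)
      + (gamma n.+1 * gamma n) *: ('X * P n * P n.-1)); last first.
    by rewrite -!mul_polyC; ring.
  rewrite !raddfD/= !scalarZ LX' LX orth_mulX.
  case: (n) => [|m]; first by rewrite -(gammaS 1) gamma0; ring.
  rewrite LX' [m.+3 == _]gtn_eqF ?[m == _]ltn_eqF; [|by lia..].
  by rewrite -(gammaS m.+2) -(gammaS m.+1); ring.
rewrite L_structure mulrBl raddfB/= LfP.
rewrite (_ : _ * P n.+1 = 2 *: ('X * ('X * P n.+1) * ('X * P n))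
    - (2 * (z ^+ 2 + 1)) *: ('X * P n * P n.+1)); last first.
  by rewrite /f -!mul_polyC; ring.
rewrite raddfB/= !scalarZ LX3 LX; ring.
Qed.

Let L_structure_parity n k :
  odd (n.+1 + k) -> L (f * (P n)^`() * P k) = 0.
Proof.
move=> onk; apply: (@functional_odd_eq0 (0 + n.+1 + k)) => //.
apply: comp_opp_mul (orth_parity k); apply: comp_opp_mul f_parity _.
exact/comp_opp_deriv/orth_parity.
Qed.

(* The truncated indices [n.-1] and [n.-2] are harmless: their coefficients
   vanish with [gamma 0] when the paper's index is negative. *)
Lemma structure_relation n :
  f * (P n.+1)^`() = n.+1%:R *: P n.+2
   + ((2 * (gamma n + gamma n.+1 + gamma n.+2 - z ^+ 2 - 1) - n%:R)
      * gamma n.+1) *: P n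
   + (2 * gamma n.+1 * gamma n * gamma n.-1) *: P n.-2.
Proof.
apply: orth_eq => k.
set F := f * _; set a := (_ - _) * _; set b := 2 * _ * _ * _.
rewrite 2!mulrDl !raddfD/= -!scalerAl !scalarZ {}/F {}/a {}/b.
rewrite [L (P n.+2 * P k)]LPP [L (P n * P k)]LPP [L (P n.-2 * P k)]LPP.
case: (ltngtP k n.+1) => [kn|nk|->].
- rewrite [n.+2 == k]gtn_eqF ?mulr0 ?add0r; last by lia.
  move: kn; rewrite ltnS leq_eqVlt => /predU1P[->|kn].
    rewrite L_structure_diag eqxx -[_ * gamma n.+1 * h n]mulrA gammaS.
    case: n => [|[|m]].
    + by rewrite /= gamma0 !(mulr0, mul0r, addr0).
    + by rewrite /= gamma0 !(mulr0, mul0r, addr0).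
    + by rewrite /= ltn_eqF ?mulr0 ?addr0.
  rewrite gtn_eqF// mulr0 add0r; move: kn; rewrite leq_eqVlt => /predU1P[nk|kn].
    (* Here [n = k + 1]. Truncation makes [n.-2] equal to [k] when [k = 0], but the coefficient then
       contains [gamma 0]. *)
    rewrite -nk [k.+1.-2 == k](_ : _ = (k == 0%N)); last first.
      by case: (k) => // m /=; lia.
    transitivity (0 : R); last first.
      by case: (k) => [|m]; rewrite /= ?gamma0 ?mulr0 ?mul0r.
    by rewrite L_structure_parity// !addSn addnn /= odd_double.
  case: n kn => [|[|n]]//; rewrite !ltnS => kn.
  rewrite L_structure_low// eq_sym.
  case: eqVneq => [->|_]; last by rewrite mulr0.
  (* The three factors [gamma] telescope, carrying [h n] up to [h n.+3]. *)
  by do 3! rewrite -[_ * gamma _ * h _]mulrA gammaS.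
- rewrite (ltn_eqF (ltnW nk)) [n.-2 == k]ltn_eqF ?mulr0 ?addr0; last by lia.
  (* With [k = n + 2 + i], the left side has degree at most [n + 2], so only [i = 0] gives a nonzero
     moment. *)
  rewrite -(subnKC nk); move: (k - n.+2)%N => {nk}i.
  rewrite orth_lead; last first.
    apply/leq_sizeP => -[|[|j]] ij; [by lia|by lia|].
    by rewrite coef_fM !coef_deriv !coef_P_gt ?mul0rn ?mulr0 ?subr0//; lia.
  rewrite !addSn coef_fM !coef_deriv (@coef_P_gt _ (n + i).+3); last by lia.
  rewrite mul0rn mulr0 subr0.
  case: i => [|i]; first by rewrite addn0 eqxx coef_P.
  by rewrite coef_P_gt ?mul0rn ?mul0r ?ltn_eqF ?mulr0//; lia.
- rewrite gtn_eqF// ltn_eqF// [n.-2 == _]ltn_eqF ?mulr0 ?addr0; last by lia.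
  by rewrite L_structure_parity// addSn addnn /= odd_double.
Qed.

End orthogonal_polynomials.

Lemma finite_set_root (R : idomainType) (q : {poly R}) :
  q != 0 -> finite_set [set x | root q x].
Proof.
move=> q0; apply: contrapT => /infinite_set_fset - /(_ (size q))[B Bq].
rewrite leqNgt => /negP; apply; apply: max_poly_roots => //.
  by apply/allP => x xB; exact: Bq.
exact: finmap.fset_uniq.
Qed.

(** * The truncated Gaussian functional: definiteness, Pearson equation, evenness *)

Section hermite_functional.
Variables (R : realType) (z : R).
Local Notation mu := (@lebesgue_measure R).

Let w (x : R) := expR (- x ^+ 2).

Let continuous_integrand (q : {poly R}) : continuous (fun x => q.[x] * w x).
Proof.
move=> x; apply: continuousM; first exact: continuous_horner.
by apply/differentiable_continuous/derivable1_diffP; apply: ex_derive.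
Qed.

Let integrable_integrand (q : {poly R}) :
  mu.-integrable `[- z, z] (EFin \o (fun x => q.[x] * w x)).
Proof.
apply: continuous_compact_integrable; first exact: segment_compact.
exact/continuous_subspaceT/continuous_integrand.
Qed.

Lemma hermite_functional_is_linear :
  GRing.linear_for *%R (hermite_functional z).
Proof.
move=> a p q; rewrite /hermite_functional.
under eq_Rintegral do rewrite hornerD hornerZ mulrDl -mulrA.
rewrite RintegralD//=.
- by rewrite RintegralZl//; exact: integrable_integrand.
- apply: eq_integrable (integrable_integrand (a *: p)) => //= x _.
  by rewrite /= hornerZ mulrA.
Qed.

HB.instance Definition _ :=
  GRing.isLinear.Build R {poly R} R *%R (hermite_functional z)
    hermite_functional_is_linear.

Hypothesis hz : 0 < z.

(** A nonnegative integrand with zero integral vanishes almost everywhere. If [q] were nonzero, its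
    finitely many roots and a null set would cover [[- z, z]], which has measure [2 z > 0]. *)
Lemma hermite_functional_sqr_eq0 (q : {poly R}) :
  hermite_functional z (q ^+ 2) = 0 -> q = 0.
Proof.
move=> Lq0; apply/eqP/negP => /negP qn0.
have intq := integrable_integrand (q ^+ 2).
pose I : set R := `[- z, z]%classic.
have mI : measurable I by exact: measurable_itv.
have /(ae_eq_integral_abs mu mI) :
    (\int[mu]_(x in I) `|((q ^+ 2).[x] * w x)%:E| = 0)%E.
  rewrite -[RHS]/(0%:E) -Lq0 /hermite_functional /Rintegral fineK; last first.
    exact: integrable_fin_num.
  apply: eq_integral => x _; rewrite gee0_abs// lee_fin mulr_ge0 ?expR_ge0//.
  by rewrite horner_exp sqr_ge0.
case.
  exact: measurable_int intq.
move=> N [mN N0 sub].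
have cZ : countable [set x | root q x].
  exact/finite_set_countable/finite_set_root.
have mZ : measurable ([set x | root q x] : set (measurableTypeR R)).
  by apply: countable_measurable cZ => t; exact: measurable_set1.
have IN : I `<=` N `|` [set x | root q x].
  move=> x xI; have [qx|qx] := boolP (root q x); [by right|left].
  apply: sub => /= /(_ xI)[] /eqP; rewrite mulf_eq0 (gt_eqF (expR_gt0 _)) orbF.
  by rewrite horner_exp sqrf_eq0; exact/negP.
have NZ0 : mu (N `|` [set x | root q x]) = 0.
  by apply: null_set_setU => //; exact: countable_lebesgue_measure0.
have : mu I = 0 by apply: subset_measure0 NZ0 => //; exact: measurableU.
rewrite lebesgue_measure_itv /= lte_fin gtrN// -EFinB => /eqP.
by rewrite eqe opprK -mulr2n mulrn_eq0/= gt_eqF.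
Qed.

(** The fundamental theorem of calculus for [q.[x] * w x]; the weight takes the same value at both
    endpoints. *)
Lemma hermite_functional_deriv (q : {poly R}) :
  hermite_functional z (q^`() - (2 *: 'X) * q) =
  (q.[z] - q.[- z]) * expR (- z ^+ 2).
Proof.
have dF (x : R) :
    is_derive x 1 (fun x => q.[x] * w x) ((q^`() - 2 *: 'X * q).[x] * w x).
  by apply: is_derive_eq; rewrite /w /GRing.scale !hornerE /=; ring.
rewrite /hermite_functional /Rintegral.
rewrite (@continuous_FTC2 _ _ (fun x => q.[x] * w x)).
- by rewrite /= /w sqrrN mulrBl.
- by rewrite gtrN.
- exact/continuous_subspaceT/continuous_integrand.
- split=> [x _||].
  + exact: ex_derive.
  + exact/cvg_at_right_filter/continuous_integrand.
  + exact/cvg_at_left_filter/continuous_integrand.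
- by move=> x _; rewrite derive1E; apply: derive_val.
Qed.

Lemma hermite_functional_pearson (q : {poly R}) :
  hermite_functional z (phi z * q^`()) =
  hermite_functional z (2 *: 'X * (phi z - 1) * q).
Proof.
have phi0 x : x ^+ 2 = z ^+ 2 -> (phi z * q).[x] = 0.
  move=> xz.
  by rewrite hornerM /phi hornerD hornerN hornerXn hornerC xz subrr mul0r.
have := hermite_functional_deriv (phi z * q).
rewrite !phi0 ?sqrrN// subrr mul0r => /eqP.
rewrite (_ : _ - _ = phi z * q^`() - 2 *: 'X * (phi z - 1) * q); last first.
  rewrite /phi derivM derivB derivC derivXn -!mul_polyC; ring.
by rewrite raddfB subr_eq0 => /eqP.
Qed.

(* Integrating the derivative of x^(2n) exp(-x^2), whose boundary terms cancel,
   links consecutive odd moments. *)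
Let hermite_functional_odd n : hermite_functional z 'X^(n.*2.+1) = 0.
Proof.
elim: n => [|n IHn].
  have := hermite_functional_deriv 1.
  rewrite !hornerC subrr mul0r derivC sub0r mulr1 raddfN/= scalarZ/= => /eqP.
  by rewrite oppr_eq0 mulf_eq0 pnatr_eq0 => /eqP.
have := hermite_functional_deriv 'X^(n.+1.*2).
rewrite !hornerXn exprNn -signr_odd odd_double mul1r subrr mul0r.
rewrite derivXn -scalerAl -exprS raddfB raddfMn/= scalarZ/= IHn.
move=> /eqP; rewrite mul0rn sub0r oppr_eq0 mulf_eq0 pnatr_eq0.
by move=> /eqP.
Qed.

(** Monomial by monomial: even powers are fixed by the substitution, and odd moments vanish. *)
Lemma hermite_functional_comp_opp (q : {poly R}) :
  hermite_functional z (q \Po - 'X) = hermite_functional z q.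
Proof.
rewrite -[q in RHS]coefK comp_polyE poly_def !raddf_sum /=.
apply: eq_bigr => i _; rewrite !scalarZ/= exprNn -signr_odd.
case: (boolP (odd i)) => [oi|_]; last by rewrite mul1r.
rewrite -[i : nat]odd_double_half oi mulN1r raddfN/=.
by rewrite !hermite_functional_odd oppr0.
Qed.

End hermite_functional.

Theorem theorem17 (R : realType) (z : R) (P : nat -> {poly R})
  (hz : 0 < z) (hP : truncated_hermite z P) (n : nat) :
  phi z * (P n.+1)^`() =
    n.+1%:R *: P n.+2 + lambda z P n *: P n
    + tau z P n *: poly_ext P (n%:Z - 2).
Proof.
case: hP => P_monic_size P_orth.
have P_monic k : P k \is monic by case: (P_monic_size k).
have size_P k : size (P k) = k.+1 by case: (P_monic_size k).
have P_orth' k m : k != m -> hermite_functional z (P k * P m) = 0.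
  by rewrite P_orth => /negPf->.
have := structure_relation (hermite_functional_sqr_eq0 hz) P_monic size_P
  P_orth' (hermite_functional_comp_opp hz) (hermite_functional_pearson hz) n.
(* For [n = 0] and [n = 1] the truncated [n.-2] and the integer [n - 2] disagree, but both
   coefficients contain a vanishing [gamma]. From [n = 2] on the indices agree. *)
case: n => [|[|n]] ->.
- by rewrite /tau /= /recurrence_coef !(mulr0, mul0r) !scale0r.
- by rewrite /tau /= /recurrence_coef !(mulr0, mul0r) !scale0r.
- rewrite /tau (_ : n.+2%:Z - 2 = n%:Z) 1?(_ : n.+2%:Z - 1 = n.+1%:Z) //; lia.
Qed.
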